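(* Let $n$ be odd and let $\mathrm{Maj}_n:\{-1,1\}^n\to\{-1,1\}$, $\mathrm{Maj}_n(x^n)=\operatorname{sgn}\left(\sum_{i=1}^n x_i\right)$. Then $\mathrm{Maj}_n$ is uniformly self-predicting, i.e., it is $\rho$-SP for every $\rho\in[0,1]$.
   Context: Let $X^n$ be uniform on $\{-1,1\}^n$ and, for $\rho\in[0,1]$, let $Y^n$ be obtained from $X^n$ by flipping each coordinate independently with probability $\delta=(1-\rho)/2$. For $f:\{-1,1\}^n\to\{-1,1\}$ define the noise operator $T_\rho f(y^n)=\mathbb{E}[f(X^n)\mid Y^n=y^n]=\sum_{S\subseteq[n]}\rho^{|S|}\hat f_S\, y^S$, where $y^S=\prod_{i\in S}y_i$ and $\hat f_S=\mathbb{E}[f(X^n)X^S]$. The sign function satisfies $\operatorname{sgn}(0)=0$. The function $f$ is $\rho$-self-predicting ($\rho$-SP) at $y^n$ if $f(y^n)=\operatorname{sgn}T_\rho f(y^n)$ whenever $T_\rho f(y^n)\neq 0$; it is $\rho$-SP if it is $\rho$-SP at every $y^n\in\{-1,1\}^n$. *)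

(* Defs.v *)
From HB Require Import structures.
From mathcomp Require Import all_boot all_order all_algebra.
From mathcomp Require Import reals.

Set Implicit Arguments.
Unset Strict Implicit.
Unset Printing Implicit Defensive.

Import Order.TTheory GRing.Theory Num.Theory.
Local Open Scope ring_scope.

(* The cube {-1,1}^n, encoded by bits: the i-th coordinate of x as a real     *)
(* number is (-1) ^+ x i, so [false] stands for 1 and [true] for -1.          *)
Definition cube (n : nat) := {ffun 'I_n -> bool}.

Section SelfPredicting.
Variables (R : realType) (n : nat).
Implicit Types (x y : cube n) (f : cube n -> R) (rho : R) (S : {set 'I_n}).

Definition coord x (i : 'I_n) : R := (-1) ^+ (x i).

Definition uniform_pmf x : R := (#|{: cube n}|%:R)^-1.

Definition flip_prob rho : R := (1 - rho) / 2.

Definition channel rho x y : R :=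
  \prod_i (if y i != x i then flip_prob rho else 1 - flip_prob rho).

Definition joint_pmf rho x y : R := uniform_pmf x * channel rho x y.

Definition output_pmf rho y : R := \sum_x joint_pmf rho x y.

(* E[f(X) | Y = y]; the division is never by 0, by [output_pmfE] below. *)
Definition noise rho f y : R :=
  (\sum_x f x * joint_pmf rho x y) / output_pmf rho y.

Definition SP_at rho f y : Prop :=
  noise rho f y != 0 -> f y = Num.sg (noise rho f y).

Definition SP rho f : Prop := forall y, SP_at rho f y.

Definition uniformly_SP f : Prop := forall rho, 0 <= rho <= 1 -> SP rho f.

Definition Maj x : R := Num.sg (\sum_i coord x i).

(* Functions {-1,1}^n -> {-1,1} are represented as real-valued ones; for odd  *)
(* n, [Maj] does take its values in {-1,1}.                                   *)
Lemma Maj_pm1 x : odd n -> Maj x = 1 \/ Maj x = -1.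
Proof.
move=> on; rewrite /Maj.
suff: \sum_i coord x i != 0.
  case: sgrP => // _ _; [by left | by right].
pose k := \sum_(i < n) (x i : nat).
have -> : \sum_i coord x i = n%:R - (k.*2)%:R.
  rewrite -[in n%:R](card_ord n) -sum1_card -muln2 /k big_distrl /= !natr_sum.
  rewrite -sumrB; apply: eq_bigr => i _; rewrite /coord.
  by case: (x i); rewrite /= ?subr0 // mul1n -[1%:R]/(1 : R) opprD addrA subrr sub0r.
rewrite subr_eq0 eqr_nat; apply/negP => /eqP e.
by move: on; rewrite e odd_double.
Qed.

Definition monomial S x : R := \prod_(i in S) coord x i.

Definition fourier f S : R := \sum_x uniform_pmf x * (f x * monomial S x).

Lemma channelE rho x y :
  channel rho x y =
  2 ^- n * \sum_(S : {set 'I_n}) rho ^+ #|S| * (monomial S x * monomial S y).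
Proof.
have -> : channel rho x y =
    \prod_(i < n) (2^-1 * (rho * (coord x i * coord y i) + 1)).
  apply: eq_bigr => i _; rewrite /coord /flip_prob.
  have h : (1 : R) - (1 - rho) / 2 = 2^-1 * (rho + 1).
    rewrite {1}(splitr 1) mulrBl opprB addrACA subrr addr0 mulrDr [1/2]mul1r.
    by rewrite addrC mulr1 mulrC.
  by case: (x i); case: (y i);
    rewrite /= ?expr0 ?expr1 ?mulrNN ?mulr1 ?mul1r ?h ?mulrN1 // mulrC addrC.
rewrite big_split /= prodr_const card_ord exprVn; congr (_ * _).
rewrite bigA_distr; apply: eq_bigr => S _.
by rewrite -big_mkcond /= !big_split /= prodr_const.
Qed.

Lemma output_pmfE rho y : output_pmf rho y = 2 ^- n.
Proof.
rewrite /output_pmf /joint_pmf -big_distrr /=.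
suff -> : \sum_x channel rho x y = 1.
  by rewrite mulr1 /uniform_pmf card_ffun card_bool card_ord natrX.
rewrite /channel -(bigA_distr_bigA (fun i (b : bool) =>
  if y i != b then flip_prob rho else 1 - flip_prob rho)) /=.
rewrite big1 // => i _; rewrite big_bool /=.
by case: (y i) => /=; rewrite ?subrK // addrC subrK.
Qed.

Lemma noise_fourier rho f y :
  noise rho f y = \sum_(S : {set 'I_n}) rho ^+ #|S| * fourier f S * monomial S y.
Proof.
rewrite /noise output_pmfE invrK.
under eq_bigr => x _ do
  rewrite /joint_pmf channelE [2 ^- n * _]mulrC !mulrA.
rewrite -big_distrl /= mulfVK; last by rewrite expf_neq0 // pnatr_eq0.
under eq_bigr => x _ do rewrite big_distrr /=.
rewrite exchange_big /=; apply: eq_bigr => S _.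
rewrite /fourier big_distrr big_distrl /=; apply: eq_bigr => x _.
by rewrite !mulrA [_ * rho ^+ _]mulrC [f x * _]mulrC !mulrA.
Qed.

End SelfPredicting.

(* Main.v *)
Require Import Defs.
From HB Require Import structures.
From mathcomp Require Import all_boot all_order all_algebra.
From mathcomp Require Import reals.
From mathcomp Require Import perm zify ring lra.

(* Let y have at least as many coordinates 1 as -1. Since Maj is odd and      *)
(* symmetric, T Maj (y') = - T Maj (y) for every permutation y' of -y, and y' *)
(* can be chosen with y' <= y coordinatewise. Hence                           *)
(*   2 T Maj (y) = sum_x Maj(x) (P(x, y) - P(x, y')).                         *)
(* Let x' be x with its coordinates flipped where y and y' differ; averaging  *)
(* with the reindexed sum gives                                               *)
(*   4 T Maj (y) = sum_x (Maj(x) - Maj(x')) (P(x, y) - P(x, y')),             *)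
(* and both factors have the sign of the sum of x over those coordinates.     *)

Set Implicit Arguments.
Unset Strict Implicit.
Unset Printing Implicit Defensive.

Import Order.TTheory GRing.Theory Num.Theory.
Local Open Scope ring_scope.

Section Cube.
Variable n : nat.
Implicit Types (x y z : cube n) (p : 'S_n).

(** The core is [noise_Maj_dominated]: the noisy majority is monotone in the received word. With
    [cube_neg_perm_dominated], which supplies the permutation of -y below y, and the symmetries
    [noise_Maj_neg] and [noise_Maj_perm], it makes the noisy majority nonnegative when the
    coordinates of y have nonnegative sum. Negating y settles nonpositive sums. *)

Definition cube_neg x : cube n := [ffun i => ~~ x i].
(** In {-1,1}^n this is the coordinatewise product; adding [cube_add y z] to [x] flips [x] exactly
    where [y] and [z] differ. *)
Definition cube_add x y : cube n := [ffun i => x i (+) y i].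
Definition cube_perm p x : cube n := [ffun i => x (p i)].

Definition weight x : nat := \sum_i x i.
Definition hamming x y : nat := \sum_i (y i != x i).

Lemma cube_negK : involutive cube_neg.
Proof. by move=> x; apply/ffunP => i; rewrite !ffunE negbK. Qed.

Lemma cube_addK z : involutive (cube_add^~ z).
Proof. by move=> x; apply/ffunP => i; rewrite !ffunE addbK. Qed.

Lemma cube_perm_bij p : bijective (cube_perm p).
Proof.
by exists (cube_perm p^-1%g) => x; apply/ffunP => i;
  rewrite !ffunE ?permKV ?permK.
Qed.

Lemma weight_card x : weight x = #|[pred i | x i]|.
Proof.
rewrite -sum1_card /weight [RHS]big_mkcond; apply: eq_bigr => i _.
by rewrite inE; case: (x i).
Qed.

Lemma weight_neg x : (weight (cube_neg x) + weight x = n)%N.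
Proof.
rewrite -[RHS](card_ord n) -sum1_card -big_split; apply: eq_bigr => i _.
by rewrite ffunE; case: (x i).
Qed.

Lemma weight_perm p x : weight (cube_perm p x) = weight x.
Proof.
rewrite /weight [RHS](reindex_perm p); apply: eq_bigr => i _.
by rewrite ffunE.
Qed.

Lemma hamming_le x y : (hamming x y <= n)%N.
Proof.
rewrite -[leqRHS](card_ord n) -sum1_card; apply: leq_sum => i _.
by case: (_ != _).
Qed.

Lemma cube_sortable y : exists p, forall i, y i = (p i < weight y)%N.
Proof.
(* [p] sends a coordinate to its position in [s], a list of all coordinates with the -1s of [y]
   first. *)
pose s := enum [pred i | y i] ++ enum [pred i | ~~ y i].
have mem_s i : i \in s by rewrite mem_cat !mem_enum !inE orbN.
have size_s : size s = n.
  rewrite size_cat -!cardE -[RHS](card_ord n) -(cardC [pred i | y i]).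
  by congr (_ + _)%N; apply: eq_card => i; rewrite !inE.
have lt_s i : (index i s < n)%N by rewrite -[ltnRHS]size_s index_mem.
have inj_s : injective (fun i => Ordinal (lt_s i)).
  by move=> i j [] /(congr1 (nth i s)); rewrite !nth_index.
exists (perm inj_s) => i; rewrite permE /= weight_card cardE.
rewrite index_cat mem_enum inE; case: ifP => yi.
  by rewrite index_mem mem_enum inE yi.
by rewrite ltnNge leq_addr.
Qed.

(* As [true] encodes -1, [y i ==> z i] means z <= y as elements of {-1,1}^n.  *)
Lemma cube_neg_perm_dominated y : (weight y <= n - weight y)%N ->
  exists p, forall i, y i ==> cube_perm p (cube_neg y) i.
Proof.
move=> le_y; have [p yE] := cube_sortable y.
(* Conjugating the reversal by the sorting permutation sends the first [weight y] sorted positions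
   to the last ones. These lie beyond the -1s of [y], since at most half of the coordinates are -1,
   so [cube_neg y] is -1 there. *)
exists (p * perm (inv_inj (@rev_ordK n)) * p^-1)%g => i.
rewrite !ffunE [in ~~ _]yE !permM permKV permE /= yE.
by apply/implyP; have := ltn_ord (p i); lia.
Qed.

(** Only coordinates with [y] = 1 and [z] = -1 matter: each adds 1 to both differences, of distances
    and of weights, if [x] is 1 there, and -1 otherwise. *)
Lemma hamming_dominated x y z : (forall i, y i ==> z i) ->
  (hamming x z + weight x = hamming x y + weight (cube_add x (cube_add y z)))%N.
Proof.
move=> yz; rewrite -!big_split; apply: eq_bigr => i _.
by rewrite !ffunE; move: (yz i); case: (x i); case: (y i); case: (z i).
Qed.

End Cube.

Section MajNoise.
Variables (R : realType) (n : nat).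
Implicit Types (x y z : cube n) (p : 'S_n) (rho : R).

Lemma sum_coordE x : \sum_i Defs.coord R x i = n%:R - (weight x).*2%:R.
Proof.
rewrite -[in n%:R](card_ord n) -sum1_card -muln2 /weight big_distrl !natr_sum.
rewrite -sumrB; apply: eq_bigr => i _; rewrite /Defs.coord.
by case: (x i) => /=; [ring | rewrite subr0].
Qed.

Lemma Maj_neg x : Maj R (cube_neg x) = - Maj R x.
Proof.
rewrite /Maj -sgrN -sumrN; congr Num.sg; apply: eq_bigr => i _.
by rewrite /Defs.coord ffunE; case: (x i); rewrite ?opprK.
Qed.

Lemma Maj_perm p x : Maj R (cube_perm p x) = Maj R x.
Proof. by rewrite /Maj !sum_coordE weight_perm. Qed.

Lemma sgr_homo : {homo (@Num.sg R) : a b / a <= b}.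
Proof. by move=> a b; case: (sgrP a); case: (sgrP b) => *; lra. Qed.

Lemma Maj_weight_homo x y : (weight x <= weight y)%N -> Maj R y <= Maj R x.
Proof.
move=> le_xy; rewrite /Maj !sum_coordE; apply: sgr_homo.
by rewrite lerD2l lerN2 ler_nat leq_double.
Qed.

Lemma channel_hamming rho x y :
  channel rho x y = flip_prob rho ^+ hamming x y *
                    (1 - flip_prob rho) ^+ (n - hamming x y).
Proof.
have -> : (n - hamming x y = \sum_i (y i == x i))%N.
  apply/eqP; rewrite -(eqn_add2r (hamming x y)) subnK ?hamming_le //.
  apply/eqP; rewrite -[LHS](card_ord n) -sum1_card -big_split.
  by apply: eq_bigr => i _; case: (_ == _).
rewrite -!prodrXr -big_split; apply: eq_bigr => i _.
by case: (y i == x i) => /=; rewrite ?mul1r ?mulr1.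
Qed.

Lemma channel_hamming_homo rho x y z : 0 <= rho <= 1 ->
  (hamming x y <= hamming x z)%N -> channel rho x z <= channel rho x y.
Proof.
move=> /andP[rho0 rho1] le_d; rewrite !channel_hamming.
have d0 : 0 <= flip_prob rho by rewrite /flip_prob; lra.
have dd : flip_prob rho <= 1 - flip_prob rho by rewrite /flip_prob; lra.
have c0 := le_trans d0 dd.
have le_n := hamming_le x z.
(* After removing common factors, the k extra flips compare the k-th powers of [flip_prob rho] and
   [1 - flip_prob rho]. *)
rewrite -(subnK le_d) addnC exprD -mulrA ler_wpM2l ?exprn_ge0 //.
have -> : (n - hamming x y = (hamming x z - hamming x y)
    + (n - (hamming x y + (hamming x z - hamming x y))))%N by lia.
by rewrite exprD ler_wpM2r ?exprn_ge0 // lerXn2r ?nnegrE.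
Qed.

Lemma channel_neg rho x y :
  channel rho (cube_neg x) (cube_neg y) = channel rho x y.
Proof.
by apply: eq_bigr => i _; rewrite !ffunE; case: (x i); case: (y i).
Qed.

Lemma channel_perm rho p x y :
  channel rho (cube_perm p x) (cube_perm p y) = channel rho x y.
Proof.
rewrite /channel [RHS](reindex_perm p); apply: eq_bigr => i _.
by rewrite !ffunE.
Qed.

(** Modulo 2, (x + y + z) + y = x + z, so the flip pattern is the same. *)
Lemma channel_swap rho x y z :
  channel rho (cube_add x (cube_add y z)) y = channel rho x z.
Proof.
by apply: eq_bigr => i _; rewrite !ffunE; case: (x i); case: (y i); case: (z i).
Qed.

(** Input and output are both uniform, so the factors 2^-n in Bayes' rule cancel. *)
Lemma noiseE rho (f : cube n -> R) y :
  noise rho f y = \sum_x f x * channel rho x y.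
Proof.
rewrite /noise output_pmfE big_distrl; apply: eq_bigr => x _ /=.
rewrite /joint_pmf /uniform_pmf card_ffun card_bool card_ord natrX.
rewrite mulrCA [_ * (f x * _)]mulrC mulfK // invr_neq0 //.
by rewrite expf_neq0 // pnatr_eq0.
Qed.

Lemma noise_Maj_neg rho y :
  noise rho (@Maj R n) (cube_neg y) = - noise rho (@Maj R n) y.
Proof.
rewrite !noiseE (reindex_inj (inv_inj (@cube_negK n))) -sumrN.
by apply: eq_bigr => x _; rewrite Maj_neg channel_neg mulNr.
Qed.

Lemma noise_Maj_perm rho p y :
  noise rho (@Maj R n) (cube_perm p y) = noise rho (@Maj R n) y.
Proof.
rewrite !noiseE (reindex_inj (bij_inj (cube_perm_bij p))).
by apply: eq_bigr => x _; rewrite Maj_perm channel_perm.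
Qed.

Lemma noise_Maj_dominated rho y z : 0 <= rho <= 1 ->
  (forall i, y i ==> z i) ->
  noise rho (@Maj R n) z <= noise rho (@Maj R n) y.
Proof.
move=> rho01 yz; pose fl x := cube_add x (cube_add y z).
have swapE : noise rho (@Maj R n) y - noise rho (@Maj R n) z =
    \sum_x Maj R (fl x) * (channel rho x z - channel rho x y).
  rewrite !noiseE -sumrB (reindex_inj (inv_inj (cube_addK (cube_add y z)))).
  apply: eq_bigr => x _; rewrite channel_swap -mulrBr; congr (_ * (_ - _)).
  rewrite -(channel_swap rho x z y); congr channel.
  by apply/ffunP => i; rewrite !ffunE [y i (+) _]addbC.
(* The difference is doubled; one copy is expanded by [swapE], the other directly, so that each
   summand factors. *)
rewrite -subr_ge0 -(pmulrn_lge0 _ (isT : (0 < 2)%N)) mulr2n {1}swapE !noiseE.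
rewrite -sumrB -big_split; apply: sumr_ge0 => x _ /=.
rewrite (_ : _ + _ = (Maj R x - Maj R (fl x)) *
                     (channel rho x y - channel rho x z)); last by ring.
have := hamming_dominated x yz; rewrite -/(fl x) => dE.
have [le_d|/ltnW le_d] := leqP (hamming x y) (hamming x z).
  rewrite mulr_ge0 // subr_ge0; last exact: channel_hamming_homo.
  by apply: Maj_weight_homo; lia.
rewrite mulr_le0 // subr_le0; last exact: channel_hamming_homo.
by apply: Maj_weight_homo; lia.
Qed.

Lemma noise_Maj_ge0 rho y : 0 <= rho <= 1 ->
  0 <= \sum_i Defs.coord R y i -> 0 <= noise rho (@Maj R n) y.
Proof.
move=> rho01; rewrite sum_coordE subr_ge0 ler_nat => le_y.
have [|p /(noise_Maj_dominated rho01)] := @cube_neg_perm_dominated n y.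
  by lia.
by rewrite noise_Maj_perm noise_Maj_neg; lra.
Qed.

Lemma noise_Maj_le0 rho y : 0 <= rho <= 1 ->
  \sum_i Defs.coord R y i <= 0 -> noise rho (@Maj R n) y <= 0.
Proof.
move=> rho01 le0; rewrite -oppr_ge0 -noise_Maj_neg; apply: noise_Maj_ge0 => //.
have := weight_neg y; move: le0; rewrite !sum_coordE subr_le0 subr_ge0 !ler_nat.
by lia.
Qed.

End MajNoise.

Theorem theorem3p5 (R : realType) (n : nat) (n_odd : odd n) :
  uniformly_SP (@Maj R n).
Proof.
move=> rho rho01 y noise_neq0; rewrite {1}/Maj.
have ge0 := @noise_Maj_ge0 R n rho y rho01.
have le0 := @noise_Maj_le0 R n rho y rho01.
case: (ltgtP (\sum_i Defs.coord R y i) 0) ge0 le0 =>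
  [s_lt0 _ | s_gt0 + _ | -> ].
- by move=> /(_ isT) le0; rewrite !ltr0_sg // lt_neqAle noise_neq0.
- by move=> /(_ isT) ge0; rewrite !gtr0_sg // lt_neqAle eq_sym noise_neq0.
(* At a tie both bounds apply and force the noise value to be 0, against [noise_neq0]. *)
- move=> /(_ isT) ge0 /(_ isT) le0.
  by move: noise_neq0; rewrite eq_le ge0 le0.
Qed.
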